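(* Let $(T_n)_{n\ge -3}$ be the Padovan sequence. For every integer $n\ge 0$, $$T_n^3+T_{n-1}^3+T_{n-2}^3-T_nT_{n-1}^2-T_n^2T_{n-2}+T_{n-1}^2T_{n-2}+2T_{n-1}T_{n-2}^2-3T_nT_{n-1}T_{n-2}=1.$$
   Context: The Padovan sequence is the integer sequence defined by $T_0=0$, $T_1=1$, $T_2=1$ and $T_{n+3}=T_{n+1}+T_n$ for all $n\ge 0$, extended to negative indices by $T_{-1}=1$, $T_{-2}=0$, $T_{-3}=0$ (so that the recurrence holds for all $n\ge -3$). *)

(* Defs.v *)
From mathcomp Require Import all_boot all_order all_algebra.
Set Implicit Arguments.
Unset Strict Implicit.
Unset Printing Implicit Defensive.
Import Order.TTheory GRing.Theory Num.Theory.
Local Open Scope ring_scope.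

Fixpoint padovan_nat (n : nat) : int :=
  match n with
  | 0%N => 0
  | 1%N => 1
  | 2%N => 1
  | (m.+1 as m1).+2 => padovan_nat m1 + padovan_nat m
  end.

(* [Negz k] is the integer -(k + 1). The sequence is only indexed by n >= -3;
   the value 0 below -3 is a dummy. *)
Definition padovan (n : int) : int :=
  match n with
  | Posz m => padovan_nat m
  | Negz 0 => 1
  | Negz 1 => 0
  | Negz 2 => 0
  | Negz _ => 0
  end.

Lemma padovan_rec (n : int) :
  -3 <= n -> padovan (n + 3) = padovan (n + 1) + padovan n.
Proof.
case: n => [m _|[|[|[|k]]]] //.
have -> : Posz m + 3 = Posz m.+3 by rewrite -[m.+3]addn3 PoszD.
have -> : Posz m + 1 = Posz m.+1 by rewrite -[m.+1]addn1 PoszD.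
by [].
Qed.

(* Main.v *)
(** In [Z[x]/(x^3 - x - 1)] one has
    [x^(n+2) = T_(n-2) + T_n x + T_(n-1) x^2]. The cubic form is the norm of the
    right-hand side, and the unit [x] has norm 1. Concretely, the form is
    invariant under multiplication by [x]. *)
Require Import Defs.
From mathcomp Require Import all_boot all_order all_algebra.
From mathcomp Require Import ring.
Import Order.TTheory GRing.Theory Num.Theory.
Local Open Scope ring_scope.

Definition padovan_form (R : comNzRingType) (a b c : R) : R :=
  a ^+ 3 + b ^+ 3 + c ^+ 3 - a * b ^+ 2 - a ^+ 2 * c + b ^+ 2 * c
  + 2 * b * c ^+ 2 - 3 * a * b * c.

(** Since [x^3 = x + 1], multiplying [c + a x + b x^2] by [x] gives [b + (b + c) x + a x^2]. *)
Lemma padovan_form_shift (R : comNzRingType) (a b c : R) :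
  padovan_form R (b + c) a b = padovan_form R a b c.
Proof. by rewrite /padovan_form; ring. Qed.

Lemma padovan_succ (m : nat) :
  padovan m.+1%:Z = padovan (m%:Z - 1) + padovan (m%:Z - 2).
Proof.
have -> : m.+1%:Z = (m%:Z - 2) + 3 by rewrite -addn1 PoszD; ring.
(* The recurrence is used at index [m - 2 >= -2], within its range; for [m = 0] and [m = 1] it draws
   on the values at negative indices. *)
rewrite padovan_rec; last by rewrite lerBrDr.
by congr (padovan _ + _); ring.
Qed.

Theorem mainTheorem3 (n : int) (hn : 0 <= n) :
  padovan n ^+ 3 + padovan (n - 1) ^+ 3 + padovan (n - 2) ^+ 3
  - padovan n * padovan (n - 1) ^+ 2
  - padovan n ^+ 2 * padovan (n - 2)
  + padovan (n - 1) ^+ 2 * padovan (n - 2)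
  + 2 * padovan (n - 1) * padovan (n - 2) ^+ 2
  - 3 * padovan n * padovan (n - 1) * padovan (n - 2) = 1.
Proof.
case: n hn => // m _; rewrite -[LHS]/(padovan_form _ _ _ _).
(* The base triple is [(T_0, T_(-1), T_(-2)) = (0, 1, 0)], where only the term [b ^+ 3] survives. *)
elim: m => [//|m IHm].
have -> : m.+1%:Z - 1 = m%:Z by rewrite -addn1 PoszD; ring.
have -> : m.+1%:Z - 2 = m%:Z - 1 by rewrite -addn1 PoszD; ring.
by rewrite padovan_succ padovan_form_shift.
Qed.
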